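(* For $n\ge 1$, let $\mathbf{c}\in \mathrm{GF}(2)^n$, $d\in \mathrm{GF}(2)$, and let $p_l:\mathrm{GF}(2)^n\to\mathrm{GF}(2)$ be the line function in $n$ variables, $p_l(\mathbf{x})=\sum_{j=0}^{n-2}x_jx_{j+1}+\mathbf{c}\cdot\mathbf{x}+d$. Let $K_n^{IHN}$ be the number of flat spectra of $p_l$ with respect to $\{I,H,N\}^n$, and set $K_0^{IHN}=1$. Then $K_1^{IHN}=2$, $K_n^{IHN}=2\left(K_{n-1}^{IHN}+K_{n-2}^{IHN}\right)$ for all $n\ge 2$, and in closed form $$K_n^{IHN}=\frac{(1+\sqrt3)^{n+1}-(1-\sqrt3)^{n+1}}{2\sqrt3}\qquad(n\ge 0).$$
   Context: Let $I$ be the $2\times 2$ identity matrix, $H=\frac{1}{\sqrt2}\begin{pmatrix}1&1\\1&-1\end{pmatrix}$, and $N=\frac{1}{\sqrt2}\begin{pmatrix}1&i\\1&-i\end{pmatrix}$ with $i^2=-1$. $\{I,H,N\}^n$ denotes the set of $3^n$ transforms $U=U_0\otimes U_1\otimes\cdots\otimes U_{n-1}$ with each $U_j\in \{I,H,N\}$ (the factor $U_j$ acts on the tensor position of variable $x_j$); each transform is identified with the choice $(U_0,\ldots,U_{n-1})$. For a Boolean function $p:\mathrm{GF}(2)^n\to\mathrm{GF}(2)$, let $(-1)^{p}\in\mathbb{C}^{2^n}$ be the vector with entries $(-1)^{p(\mathbf{x})}$ indexed by $\mathbf{x}=(x_0,\ldots,x_{n-1})\in\mathrm{GF}(2)^n$.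 The spectrum of $p$ with respect to $U$ is $P=U(-1)^p=(P_{\mathbf{k}})_{\mathbf{k}\in\mathrm{GF}(2)^n}$, and it is flat if $|P_{\mathbf{k}}|=1$ for all $\mathbf{k}$. The number of flat spectra of $p$ with respect to $\{I,H,N\}^n$ is the number of choices $(U_0,\ldots,U_{n-1})$ for which the spectrum of $p$ is flat. *)

(* Defs.v *)
From HB Require Import structures.
From mathcomp Require Import all_boot all_order all_algebra.
From mathcomp Require Import reals complex.

Set Implicit Arguments.
Unset Strict Implicit.
Unset Printing Implicit Defensive.

Import Order.TTheory GRing.Theory Num.Theory.
Local Open Scope ring_scope.

Inductive ihn := gateI | gateH | gateN.

Definition ihn_to_ord (g : ihn) : 'I_3 :=
  match g with gateI => inord 0 | gateH => inord 1 | gateN => inord 2 end.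

Definition ihn_of_ord (i : 'I_3) : ihn :=
  match nat_of_ord i with 0%N => gateI | 1%N => gateH | _ => gateN end.

Lemma ihn_to_ordK : cancel ihn_to_ord ihn_of_ord.
Proof. by case; rewrite /ihn_of_ord /= inordK. Qed.

HB.instance Definition _ := Finite.copy ihn (can_type ihn_to_ordK).

Definition mx2 (T : Type) (a b c d : T) : 'M[T]_2 :=
  \matrix_(r, s) if r == 0 then (if s == 0 then a else b)
                 else (if s == 0 then c else d).

Definition gate_mx (R : realType) (g : ihn) : 'M[R[i]]_2 :=
  match g with
  | gateI => 1%:M
  | gateH => ((Num.sqrt (2 : R))^-1)%:C%C *: mx2 1 1 1 (-1)
  | gateN => ((Num.sqrt (2 : R))^-1)%:C%C *: mx2 1 'i%C 1 (- 'i%C)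
  end.

(* Entry (k, x) of U_0 (x) ... (x) U_(n-1), rows and columns being indexed by
   GF(2)^n instead of by 'I_(2 ^ n); 'F_2 is convertible to 'I_2. *)
Definition tensor_entry (R : realType) (n : nat) (U : {ffun 'I_n -> ihn})
    (k x : 'rV['F_2]_n) : R[i] :=
  \prod_(j < n) gate_mx R (U j) (k 0 j) (x 0 j).

Definition sign_vector (R : realType) (n : nat) (p : 'rV['F_2]_n -> 'F_2)
    (x : 'rV['F_2]_n) : R[i] :=
  (-1) ^+ nat_of_ord (p x).

Definition spectrum (R : realType) (n : nat) (U : {ffun 'I_n -> ihn})
    (p : 'rV['F_2]_n -> 'F_2) (k : 'rV['F_2]_n) : R[i] :=
  \sum_(x : 'rV['F_2]_n) tensor_entry R U k x * sign_vector R p x.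

Definition flat (R : realType) (n : nat) (U : {ffun 'I_n -> ihn})
    (p : 'rV['F_2]_n -> 'F_2) : bool :=
  [forall k : 'rV['F_2]_n, `|spectrum R U p k| == 1].

Definition num_flat (R : realType) (n : nat) (p : 'rV['F_2]_n -> 'F_2) : nat :=
  #|[set U : {ffun 'I_n -> ihn} | flat R U p]|.

(* The inner sum has the single index j = i + 1, and is empty for i = n - 1. *)
Definition line_fun (n : nat) (c : 'rV['F_2]_n) (d : 'F_2)
    (x : 'rV['F_2]_n) : 'F_2 :=
  \sum_(i < n) \sum_(j < n | j == i.+1 :> nat) x 0 i * x 0 j
  + \sum_(j < n) c 0 j * x 0 j + d.

(* K_n, with an arbitrary affine part (c n, d n) chosen for each n. *)
Definition K_IHN (R : realType) (c : forall n : nat, 'rV['F_2]_n)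
    (d : nat -> 'F_2) (n : nat) : nat :=
  if n is 0%N then 1%N else num_flat R (line_fun (c n) (d n)).

(* Main.v *)
(* Summing out the variables from left to right, the partial sum over
   x_0, ..., x_(j-1) is a vector w in C^2 indexed by x_j.  Starting from (1, 1)
   and up to phases it only ever has one of three shapes: (1, +-1), (1, +-i),
   or sqrt 2 times a basis vector, and the shape reached after each gate does
   not depend on the output bit.  Flatness fails exactly when the third shape
   is met by the gate I or is left at the end, so flat spectra are counted by
   a three-state automaton, whose transition counts give the recurrence. *)
Require Import Defs.
From mathcomp Require Import all_boot all_order all_algebra.
From mathcomp Require Import reals complex.
From mathcomp Require Import ring.

Set Implicit Arguments.
Unset Strict Implicit.
Unset Printing Implicit Defensive.

Import Order.TTheory GRing.Theory Num.Theory.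
Local Open Scope ring_scope.

(** * Splitting off the first entry of a finite function *)

Section FfunCons.
Variables (T : finType) (n : nat).

Definition ffcons (a : T) (f : {ffun 'I_n -> T}) : {ffun 'I_n.+1 -> T} :=
  [ffun i => oapp f a (unlift ord0 i)].

Definition fftail (f : {ffun 'I_n.+1 -> T}) : {ffun 'I_n -> T} :=
  [ffun i => f (lift ord0 i)].

Lemma ffcons0 a f : ffcons a f ord0 = a.
Proof. by rewrite ffunE unlift_none. Qed.

Lemma ffconsS a f i : ffcons a f (lift ord0 i) = f i.
Proof. by rewrite ffunE liftK. Qed.

Lemma ffconsK a f : fftail (ffcons a f) = f.
Proof. by apply/ffunP => i; rewrite ffunE ffconsS. Qed.

Lemma ffcons_tail (f : {ffun 'I_n.+1 -> T}) : ffcons (f ord0) (fftail f) = f.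
Proof.
by apply/ffunP => i; rewrite ffunE; case: unliftP => [j|] -> //=; rewrite ffunE.
Qed.

Lemma sum_ffcons (V : nmodType) (F : {ffun 'I_n.+1 -> T} -> V) :
  \sum_f F f = \sum_a \sum_f F (ffcons a f).
Proof.
rewrite pair_bigA (reindex (fun p => ffcons p.1 p.2)) //=.
exists (fun f : {ffun 'I_n.+1 -> T} => (f ord0, fftail f)) => [[a f]|f] _ /=.
  by rewrite ffcons0 ffconsK.
exact: ffcons_tail.
Qed.

End FfunCons.

(** * Sums over GF(2) and over the gates, and coordinates with a default value *)

Lemma F2P (a : 'F_2) : a = 0 \/ a = 1.
Proof. by case: a => [[|[|//]] ?]; [left | right]; apply: val_inj. Qed.

Lemma sumF2 (V : nmodType) (F : 'F_2 -> V) : \sum_a F a = F 0 + F 1.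
Proof.
rewrite 2!big_ord_recl big_ord0 addr0.
by congr (F _ + F _); apply: val_inj.
Qed.

Lemma sum_ihn (V : nmodType) (F : ihn -> V) :
  \sum_g F g = F gateI + F gateH + F gateN.
Proof.
rewrite (reindex ihn_of_ord) /=.
  by rewrite !big_ord_recl big_ord0 /= addr0 addrA.
apply: onW_bij; exists ihn_to_ord => [i|]; last exact: ihn_to_ordK.
by apply: val_inj; case: i => [[|[|[|//]]] ?]; rewrite /= inordK.
Qed.

(* The value is [0] for [m >= n]; the sum is the one occurring in [line_fun]. *)
Definition coord n (x : {ffun 'I_n -> 'F_2}) (m : nat) : 'F_2 :=
  \sum_(j < n | j == m :> nat) x j.

Lemma coord_cons0 n a (x : {ffun 'I_n -> 'F_2}) : coord (ffcons a x) 0 = a.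
Proof. by rewrite /coord big_mkcond big_ord_recl /= ffcons0 big1 ?addr0. Qed.

Lemma coord_consS n a (x : {ffun 'I_n -> 'F_2}) m :
  coord (ffcons a x) m.+1 = coord x m.
Proof.
rewrite /coord big_mkcond big_ord_recl /= add0r [RHS]big_mkcond.
by apply: eq_bigr => i _; rewrite ffconsS.
Qed.

(** * The automaton on shapes *)

Inductive shape := RealPhase | ImagPhase | Spike.

Definition next (s : shape) (g : ihn) : option shape :=
  match s, g with
  | RealPhase, gateI | ImagPhase, gateI => Some RealPhase
  | RealPhase, gateN | ImagPhase, gateH => Some ImagPhase
  | RealPhase, gateH | ImagPhase, gateN => Some Spike
  | Spike, gateI => None
  | Spike, _ => Some RealPhase
  end.

Fixpoint accepts n (s : shape) : {ffun 'I_n -> ihn} -> bool :=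
  match n with
  | 0 => fun _ => if s is Spike then false else true
  | m.+1 => fun U =>
      if next s (U ord0) is Some s' then accepts s' (fftail U) else false
  end.

(** * Amplitudes and the shapes of partial sums *)

Section Amplitude.
Variable R : realType.
Local Notation C := R[i].

Definition sgn (a : 'F_2) : C := (-1) ^+ nat_of_ord a.

Lemma sgn0 : sgn 0 = 1. Proof. by rewrite /sgn expr0. Qed.

Lemma sgn1 : sgn 1 = -1. Proof. by rewrite /sgn expr1. Qed.

Lemma sgnD : {morph sgn : a b / a + b >-> a * b}.
Proof.
have F2_11 : 1 + 1 = 0 :> 'F_2 by apply: val_inj.
move=> a b; case: (F2P a) => ->; case: (F2P b) => ->;
  by rewrite ?addr0 ?add0r ?F2_11 ?sgn0 ?sgn1; ring.
Qed.

Lemma sgn_or a : sgn a = 1 \/ sgn a = -1.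
Proof. by case: (F2P a) => ->; [left; exact: sgn0 | right; exact: sgn1]. Qed.

Lemma norm_sgn a : `|sgn a| = 1.
Proof. by rewrite /sgn normrX normrN1 expr1n. Qed.

(** The weight [w] carries the sum over the variables already eliminated, as a function of the first
    remaining one. At the last index [coord x i.+1] is 0, so the last variable has no right
    neighbour. *)
Definition amp n (U : {ffun 'I_n -> ihn}) (k c : {ffun 'I_n -> 'F_2})
    (w : 'F_2 -> C) : C :=
  \sum_(x : {ffun 'I_n -> 'F_2}) w (coord x 0) *
    \prod_(i < n) (gate_mx R (U i) (k i) (x i)
                   * sgn (c i * x i + x i * coord x i.+1)).

Lemma spectrumE n (U : {ffun 'I_n -> ihn}) (c k : 'rV['F_2]_n) d :
  spectrum R U (line_fun c d) k
  = sgn d * amp U [ffun i => k 0 i] [ffun i => c 0 i] (fun=> 1).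
Proof.
rewrite /spectrum /amp big_distrr /=.
rewrite (reindex (fun x : {ffun 'I_n -> 'F_2} => \row_i x i)) /=; last first.
  exists (fun x : 'rV_n => [ffun i => x 0 i]) => x _.
    by apply/ffunP => i; rewrite ffunE mxE.
  by apply/rowP => i; rewrite mxE ffunE.
apply: eq_bigr => x _.
rewrite /sign_vector -/(sgn _) /line_fun sgnD -big_split /=.
rewrite (big_morph sgn sgnD sgn0) mul1r mulrA mulrC; congr (_ * _).
rewrite /tensor_entry -big_split /=; apply: eq_bigr => i _.
rewrite !ffunE !mxE addrC; congr (_ * sgn (_ + _)).
by rewrite -big_distrr; congr (_ * _); apply: eq_bigr => j _; rewrite mxE.
Qed.

(** Transfer map summing out one variable [a]; [y] is the value of its right neighbour. *)
Definition step (g : ihn) (k c : 'F_2) (w : 'F_2 -> C) (y : 'F_2) : C :=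
  \sum_(a : 'F_2) w a * (gate_mx R g k a * sgn (c * a + a * y)).

Lemma ampS n U (k c : {ffun 'I_n.+1 -> 'F_2}) w :
  amp U k c w
  = amp (fftail U) (fftail k) (fftail c) (step (U ord0) (k ord0) (c ord0) w).
Proof.
rewrite /amp sum_ffcons exchange_big; apply: eq_bigr => x _ /=.
rewrite /step big_distrl; apply: eq_bigr => a _ /=.
rewrite coord_cons0 big_ord_recl ffcons0 coord_consS mulrA.
congr (_ * _); apply: eq_bigr => i _.
by rewrite !ffunE !liftK /= coord_consS.
Qed.

(** With no variable left, the neighbour takes its default value 0, so only [w 0] is read. *)
Lemma amp_ord0 (U : {ffun 'I_0 -> ihn}) k c w : amp U k c w = w 0.
Proof.
rewrite /amp (eq_bigr (fun=> w 0)) => [|x _]; last first.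
  by rewrite /coord !big_ord0 mulr1.
by rewrite sumr_const card_ffun [#|'I_0|]card_ord expn0.
Qed.

Lemma amp_eq0 n (U : {ffun 'I_n -> ihn}) k c w :
  w 0 = 0 -> w 1 = 0 -> amp U k c w = 0.
Proof.
move=> w0 w1; rewrite /amp big1 // => x _.
by case: (F2P (coord x 0)) => ->; rewrite ?w0 ?w1 mul0r.
Qed.

Lemma step0 g k c w :
  step g k c w 0 = w 0 * gate_mx R g k 0 + w 1 * gate_mx R g k 1 * sgn c.
Proof. by rewrite /step sumF2 !mulr0 mulr1 !addr0 sgn0 mulr1 mulrA. Qed.

Lemma step1 g k c w :
  step g k c w 1 = w 0 * gate_mx R g k 0 - w 1 * gate_mx R g k 1 * sgn c.
Proof.
rewrite /step sumF2 mulr0 add0r mul0r sgn0 mulr1 !(mulr1 (_ : 'F_2)) sgnD sgn1.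
by ring.
Qed.

Let t : C := ((Num.sqrt (2 : R))^-1)%:C%C.

Let t2 : t * t * 2 = 1.
Proof.
rewrite /t -rmorphM /= -invfM -expr2 sqr_sqrtr ?ler0n //.
by rewrite -(rmorph_nat (real_complex R)) -rmorphM /= mulVf ?pnatr_eq0.
Qed.

Let i2 : 'i%C * 'i%C = -1 :> C.
Proof. by rewrite -expr2 sqr_i. Qed.

Let norm_i : `|'i%C| = 1 :> C.
Proof. by apply/eqP; rewrite -sqrp_eq1 // -normrX sqr_i normrN1. Qed.

(** Both numbers are eighth roots of unity: their squares are ['i] and [- 'i]. *)
Let norm_t1i : `|t * (1 + 'i%C)| = 1 /\ `|t * (1 - 'i%C)| = 1.
Proof.
split; apply/eqP; rewrite -sqrp_eq1 // -normrX.
  have -> : (t * (1 + 'i%C)) ^+ 2 = t * t * (1 + 2 * 'i%C + 'i%C * 'i%C).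
    by ring.
  by rewrite i2 addrAC subrr add0r mulrA t2 mul1r norm_i.
have -> : (t * (1 - 'i%C)) ^+ 2 = t * t * (1 - 2 * 'i%C + 'i%C * 'i%C) by ring.
by rewrite i2 addrAC subrr add0r mulrN mulrA t2 mul1r normrN norm_i.
Qed.

Lemma gateI_entry k a : gate_mx R gateI k a = (k == a)%:R.
Proof. by rewrite /= mxE. Qed.

Lemma gateH0 k : gate_mx R gateH k 0 = t.
Proof. by rewrite /= !mxE /=; case: ifP; rewrite mulr1. Qed.

Lemma gateN0 k : gate_mx R gateN k 0 = t.
Proof. by rewrite /= !mxE /=; case: ifP; rewrite mulr1. Qed.

Lemma gateH1 k : gate_mx R gateH k 1 = t * sgn k.
Proof.
by case: (F2P k) => ->; rewrite ?sgn0 ?sgn1 /= !mxE /=.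
Qed.

Lemma gateN1 k : gate_mx R gateN k 1 = t * 'i%C * sgn k.
Proof.
by case: (F2P k) => ->; rewrite ?sgn0 ?sgn1 /= !mxE /= ?mulr1 ?mulrN1 ?mulrN.
Qed.

(** As [t] is the inverse of the square root of 2, the conditions on [t * w a] say that the nonzero
    entry of a spike has modulus sqrt 2. *)
Definition has_shape (s : shape) (w : 'F_2 -> C) : Prop :=
  match s with
  | RealPhase => `|w 0| = 1 /\ (w 1 = w 0 \/ w 1 = - w 0)
  | ImagPhase => `|w 0| = 1 /\ (w 1 = 'i%C * w 0 \/ w 1 = - ('i%C * w 0))
  | Spike => `|t * w 0| = 1 /\ w 1 = 0 \/ w 0 = 0 /\ `|t * w 1| = 1
  end.

Lemma stepI k c w :
  [/\ k = 0, step gateI k c w 0 = w 0 & step gateI k c w 1 = w 0]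
  \/ [/\ k = 1, step gateI k c w 0 = sgn c * w 1
        & step gateI k c w 1 = - (sgn c * w 1)].
Proof.
rewrite step0 step1 !gateI_entry.
by case: (F2P k) => ->; [left | right]; split=> //=; ring.
Qed.

(** The output bit and the linear coefficient enter only through the sign of [k + c], which at most
    exchanges the two entries of the result. *)
Lemma stepH k c w :
  step gateH k c w 0 = t * (w 0 + sgn (k + c) * w 1)
  /\ step gateH k c w 1 = t * (w 0 - sgn (k + c) * w 1).
Proof. by rewrite step0 step1 gateH0 gateH1 sgnD; split; ring. Qed.

Lemma stepN k c w :
  step gateN k c w 0 = t * (w 0 + sgn (k + c) * ('i%C * w 1))
  /\ step gateN k c w 1 = t * (w 0 - sgn (k + c) * ('i%C * w 1)).
Proof. by rewrite step0 step1 gateN0 gateN1 sgnD; split; ring. Qed.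

(** Under H, entries with ratio 1 or -1 add up in one place and cancel in the other, while ratio
    ['i] or [- 'i] is kept up to sign. N first multiplies [w 1] by ['i], so it swaps these two
    behaviours. *)
Lemma has_shape_step s g s' k c w :
  next s g = Some s' -> has_shape s w -> has_shape s' (step g k c w).
Proof.
have tt2 (z : C) : t * (t * (z + z)) = z.
  by rewrite -[RHS]mul1r -t2; ring.
have norm_plus z : `|t * (z + 'i%C * z)| = `|z|.
  have -> : t * (z + 'i%C * z) = t * (1 + 'i%C) * z by ring.
  by rewrite normrM norm_t1i.1 mul1r.
have norm_minus z : `|t * (z - 'i%C * z)| = `|z|.
  have -> : t * (z - 'i%C * z) = t * (1 - 'i%C) * z by ring.
  by rewrite normrM norm_t1i.2 mul1r.
(* This and [plusE] give the ratio of the two new entries; [auto] picks them up from the context. *)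
have minusE z : t * (z - 'i%C * z) = - ('i%C * (t * (z + 'i%C * z))).
  by ring: i2.
have plusE z : t * (z + 'i%C * z) = 'i%C * (t * (z - 'i%C * z)).
  by ring: i2.
have ii (z : C) : 'i%C * ('i%C * z) = - z by rewrite mulrA i2 mulN1r.
case: s; case: g => //= -[<-] /=.
- by move=> [nw w1]; case: (stepI k c w) => -[_ -> ->]; [split; auto|];
    split; [case: w1 => ->; rewrite normrM norm_sgn ?normrN nw mulr1 | right].
- move=> [nw w1]; have [-> ->] := stepH k c w.
  by case: w1 => ->; case: (sgn_or (k + c)) => ->;
    rewrite ?mulrN ?mulN1r ?mul1r ?opprK ?subrr ?mulr0 ?tt2; auto.
- move=> [nw w1]; have [-> ->] := stepN k c w.
  by case: w1 => ->; case: (sgn_or (k + c)) => ->;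
    rewrite ?mulrN ?mulN1r ?mul1r ?opprK ?norm_plus ?norm_minus nw; auto.
- by move=> [nw w1]; case: (stepI k c w) => -[_ -> ->]; [split; auto|];
    split; [case: w1 => ->; rewrite normrM norm_sgn ?normrN normrM norm_i nw
           !mulr1 | right].
- move=> [nw w1]; have [-> ->] := stepH k c w.
  by case: w1 => ->; case: (sgn_or (k + c)) => ->;
    rewrite ?mulrN ?mulN1r ?mul1r ?opprK ?norm_plus ?norm_minus nw; auto.
- move=> [nw w1]; have [-> ->] := stepN k c w.
  by case: w1 => ->; rewrite ?mulrN ii ?opprK; case: (sgn_or (k + c)) => ->;
    rewrite ?mulrN ?mulN1r ?mul1r ?opprK ?subrr ?mulr0 ?tt2; auto.
(* From a spike only one summand survives, so the new entries agree up to sign. *)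
- have [-> ->] := stepH k c w.
  case=> -[]; last first.
    move=> -> nw; rewrite sub0r add0r mulrN (mulrCA t).
    by split; [rewrite normrM norm_sgn mul1r | right].
  by move=> nw ->; rewrite mulr0 subr0 addr0; split; [|left].
- have [-> ->] := stepN k c w.
  case=> -[]; last first.
    move=> -> nw; rewrite sub0r add0r !mulrN !(mulrCA t).
    by split; [rewrite normrM norm_sgn mul1r normrM norm_i mul1r | right].
  by move=> nw ->; rewrite !mulr0 subr0 addr0; split; [|left].
Qed.

(** The gate I selects the entry of [w] at the first output bit; aiming that bit at the zero of the
    spike kills the amplitude. *)
Lemma spike_gateI n (U : {ffun 'I_n.+1 -> ihn}) c w :
  U ord0 = gateI -> has_shape Spike w -> exists k, amp U k c w = 0.
Proof.
move=> U0 [[_ w1]|[w0 _]].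
  exists [ffun=> 1]; rewrite ampS ffunE U0 amp_eq0 //.
    by case: (stepI 1 (c ord0) w) => -[// _ -> _]; rewrite w1 mulr0.
  by case: (stepI 1 (c ord0) w) => -[// _ _ ->]; rewrite w1 mulr0 oppr0.
exists [ffun=> 0]; rewrite ampS ffunE U0 amp_eq0 //.
  by case: (stepI 0 (c ord0) w) => -[// _ -> _].
by case: (stepI 0 (c ord0) w) => -[// _ _ ->].
Qed.

Lemma has_shape_ord0 (U : {ffun 'I_0 -> ihn}) s w :
  has_shape s w -> (`|w 0| = 1) <-> accepts s U.
Proof.
case: s => /= [[-> _]|[-> _]|sw] //; split=> // nw0.
case: sw => [[]|[w0]]; last first.
  by move: nw0; rewrite w0 normr0 => /esym/eqP; rewrite oner_eq0.
rewrite normrM nw0 mulr1 => nt _.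
(* With [t] of modulus 1 this would give 2 = 1. *)
have : `|t * t * 2| = 1 by rewrite t2 normr1.
by rewrite !normrM nt !mul1r normr_nat => /eqP; rewrite pnatr_eq1.
Qed.

(** The run of the automaton does not depend on [k], so a single run decides all output indices at
    once; [w] and [c] must vary in the induction. *)
Lemma flat_accepts n (U : {ffun 'I_n -> ihn}) c s w : has_shape s w ->
  (forall k, `|amp U k c w| = 1) <-> accepts s U.
Proof.
elim: n => [|n IH] in U c s w * => sw.
  rewrite -(has_shape_ord0 U sw).
  by split=> [/(_ [ffun=> 0])|H k]; rewrite amp_ord0.
case E: (next s (U ord0)) => [s'|] /=; rewrite E; last first.
  split=> // flatU.
  have [s_spike U0] : s = Spike /\ U ord0 = gateI.
    by move: E; case: (s); case: (U ord0).
  rewrite s_spike in sw; have [k amp0] := spike_gateI c U0 sw.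
  by have /esym/eqP := flatU k; rewrite amp0 normr0 oner_eq0.
split=> [flatU|acc k].
  (* Acceptance of the tail does not mention [k], so any first output bit serves here; 0 is
     chosen. *)
  have [+ _] := IH (fftail U) (fftail c) s' _ (has_shape_step 0 (c ord0) E sw).
  by apply=> k; have := flatU (ffcons 0 k); rewrite ampS ffcons0 ffconsK.
rewrite ampS.
by have [_] := IH (fftail U) (fftail c) s' _
  (has_shape_step (k ord0) (c ord0) E sw); apply.
Qed.

(** The run starts from the constant vector 1, of shape [RealPhase]; [d] is only a global sign. *)
Lemma flat_line n (U : {ffun 'I_n -> ihn}) c d :
  flat R U (line_fun c d) = accepts RealPhase U.
Proof.
have [amp_acc acc_amp] := @flat_accepts n U [ffun i => c 0 i] RealPhase
  (fun=> 1) (conj (normr1 _) (or_introl erefl)).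
apply/forallP/idP => [flatU | /acc_amp flatU k].
  apply: amp_acc => k; have /eqP := flatU (\row_i k i).
  rewrite spectrumE normrM norm_sgn mul1r.
  suff -> : [ffun i => (\row_j k j) 0 i] = k by [].
  by apply/ffunP => i; rewrite ffunE mxE.
by rewrite spectrumE normrM norm_sgn mul1r flatU.
Qed.

End Amplitude.

(** * Counting accepted gate sequences *)

Definition num_accepted n (s : shape) : nat :=
  \sum_(U : {ffun 'I_n -> ihn}) accepts s U.

Lemma num_accepted0 s : num_accepted 0 s = if s is Spike then 0%N else 1%N.
Proof.
rewrite /num_accepted sum_nat_const card_ffun card_ord expn0 mul1n.
by case: s.
Qed.

Lemma num_acceptedS n s :
  num_accepted n.+1 s
  = (\sum_g if next s g is Some s' then num_accepted n s' else 0)%N.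
Proof.
rewrite /num_accepted sum_ffcons; apply: eq_bigr => g _ /=.
case E: (next s g) => [s'|].
  by apply: eq_bigr => U _; rewrite ffcons0 E ffconsK.
by rewrite big1 // => U _; rewrite ffcons0 E.
Qed.

(** Exchanging H and N in the first position turns the transitions of one state into those of the
    other. *)
Lemma num_accepted_real_imag n :
  num_accepted n ImagPhase = num_accepted n RealPhase.
Proof.
case: n => [|n]; first by rewrite !num_accepted0.
by rewrite !num_acceptedS !sum_ihn /= addrAC.
Qed.

(** I and N lead to the two phase states, which have equal counts; H leads to [Spike], from which H
    and N both return to [RealPhase]. *)
Lemma num_accepted_real_rec n :
  num_accepted n.+2 RealPhase
  = (2 * (num_accepted n.+1 RealPhase + num_accepted n RealPhase))%N.
Proof.
rewrite num_acceptedS sum_ihn /= num_accepted_real_imag.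
rewrite [num_accepted n.+1 Spike]num_acceptedS sum_ihn /=.
by rewrite add0r addrAC mulnDr !mul2n -!addnn.
Qed.

Lemma K_IHN_accepted (R : realType) c d n :
  K_IHN R c d n = num_accepted n RealPhase.
Proof.
case: n => [|n]; first by rewrite num_accepted0.
rewrite /K_IHN /num_flat -sum1dep_card big_mkcond.
by apply: eq_bigr => U _; rewrite flat_line; case: accepts.
Qed.

Theorem lemma9 (R : realType) (c : forall n : nat, 'rV['F_2]_n)
    (d : nat -> 'F_2) :
  [/\ K_IHN R c d 1 = 2%N,
      forall n : nat, (2 <= n)%N ->
        K_IHN R c d n = (2 * (K_IHN R c d (n - 1) + K_IHN R c d (n - 2)))%N
    & forall n : nat,
        (K_IHN R c d n)%:R
        = ((1 + Num.sqrt 3) ^+ n.+1 - (1 - Num.sqrt 3) ^+ n.+1)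
          / (2 * Num.sqrt 3) :> R].
Proof.
have K1 : num_accepted 1 RealPhase = 2%N.
  by rewrite num_acceptedS sum_ihn /= !num_accepted0.
split=> [|[|[|n]] // _|n]; rewrite ?K_IHN_accepted //.
  by rewrite subSS subn0 subn2 /= num_accepted_real_rec.
set r := Num.sqrt 3.
have r2 : r * r = 3 by rewrite -expr2 sqr_sqrtr ?ler0n.
have r_neq0 : r != 0 by rewrite sqrtr_eq0 -ltNge ltr0n.
pose closed m := ((1 + r) ^+ m.+1 - (1 - r) ^+ m.+1) / (2 * r).
have closed_rec m : closed m.+2 = 2 * (closed m.+1 + closed m).
  (* Both [1 + r] and [1 - r] are roots of this characteristic equation. *)
  have root (x : R) : x * x = 2 * x + 2 ->
      x ^+ m.+3 = 2 * (x ^+ m.+2 + x ^+ m.+1).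
    by move=> x2; rewrite exprS exprS mulrA x2; ring.
  rewrite /closed !root; [by field | |]; by ring: r2.
(* The recurrence has order two, so the induction carries two consecutive values. *)
suff [] : (num_accepted n RealPhase)%:R = closed n
  /\ (num_accepted n.+1 RealPhase)%:R = closed n.+1 by [].
elim: n => [|n [IH0 IH1]].
  rewrite num_accepted0 K1 /closed; split; first by field.
  by field.
split=> //; rewrite num_accepted_real_rec closed_rec -IH0 -IH1.
by rewrite natrM natrD.
Qed.
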